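(* For fixed graphs $T$ and $F$ without isolated vertices, \(\operatorname{ex}(n,T,F)=|\mathcal T_{T,n}|-\alpha_T(C_{F,n})\). Equivalently, \[\operatorname{ex}(n,T,F)=\max_{\substack{y_M\in C_{F,n}\\ y_M\text{ squarefree}}}\dim_{\mathbf{k}} \pi_M(V_T(n)).\]
   Context: Let $\mathbf{k}$ be a field of characteristic zero, $R_n^{(2)}=\mathbf{k}[y_e:e\in E(K_n)]$, and for an edge set $A$ write $y_A=\prod_{e\in A}y_e$. Let $\mathcal T_{T,n}$ (resp. $\mathcal C_{F,n}$) be the set of edge sets of all copies of $T$ (resp. $F$) in $K_n$. Let $C_{F,n}=\bigcap_{A\in\mathcal C_{F,n}}(y_e:e\in A)$ be the cover ideal. Let $V_T(n)=\operatorname{span}_{\mathbf{k}}\{y_B:B\in\mathcal T_{T,n}\}$. For $M\subseteq E(K_n)$, put $\mathfrak m_M=(y_e:e\in M)$ and let $\pi_M:R_n^{(2)}\to R_n^{(2)}/\mathfrak m_M$ be the quotient map. Define $\alpha_T(C_{F,n})=\min\{\dim_{\mathbf{k}}(V_T(n)\cap\mathfrak m_M): y_M\in C_{F,n}$ squarefree$\}$ $=\min \dim_{\mathbf{k}}\ker(\pi_M|_{V_T(n)})$. $\operatorname{ex}(n,T,F)$ is the maximum number of copies of $T$ in an $F$-free graph on $n$ vertices. *)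

(* Defs.v *)
From HB Require Import structures.
From mathcomp Require Import all_boot all_order all_algebra.
From mathcomp Require Import boolp classical_sets.
From mathcomp Require Import mpoly.

Set Implicit Arguments.
Unset Strict Implicit.
Unset Printing Implicit Defensive.

Import GRing.Theory.
Local Open Scope ring_scope.

(** Finite simple graphs *)

(* A graph has at least one vertex.  For the null graph F no graph is F-free,
   so that ex(n, T, F) would be the maximum of an empty set. *)
Record sgraph := SGraph {
  vertex :> finType;
  adj : rel vertex;
  vertex_gt0 : (0 < #|vertex|)%N;
  adj_sym : ssrbool.symmetric adj;
  adj_irrefl : irreflexive adj }.

Definition no_isolated (T : sgraph) : Prop :=
  forall x : T, exists y : T, adj x y.

(** Copies of a graph in a graph on the vertex set 'I_n *)

(* E(K_n) *)
Definition edge (n : nat) : predArgType := {e : {set 'I_n} | #|e| == 2%N}.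
HB.instance Definition _ n := Finite.on (edge n).

(* A graph on 'I_n is given by its edge set G : {set edge n}; a subgraph of it
   is a pair H of a vertex set H.1 and an edge set H.2. *)
Definition is_subgraph n (H : {set 'I_n} * {set edge n}) (G : {set edge n}) :=
  (H.2 \subset G) && [forall e in H.2, val e \subset H.1].

Definition is_isomorphic n (T : sgraph) (H : {set 'I_n} * {set edge n}) :=
  [exists f : {ffun T -> 'I_n},
    [&& injectiveb f, f @: T == H.1 &
        [forall x, forall y,
           adj x y == [exists e in H.2, val e == [set f x; f y]]]]].

Definition copies n (T : sgraph) (G : {set edge n}) :=
  [set H | is_subgraph H G && is_isomorphic T H].

Definition free_of n (F : sgraph) (G : {set edge n}) := copies F G == finset.set0.

(* ex(n, T, F) *)
Definition gen_turan (n : nat) (T F : sgraph) : nat :=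
  \max_(G : {set edge n} | free_of F G) #|copies T G|.

(* This is both \mathcal T_{T,n} and, for the graph F, \mathcal C_{F,n}. *)
Definition copy_edge_sets (n : nat) (T : sgraph) : {set {set edge n}} :=
  [set H.2 | H in copies T [set: edge n]].

(** Ideals, spans and dimensions *)

Definition ideal_gen (R : comNzRingType) (G : set R) : set R :=
  fun p => exists (m : nat) (a g : 'I_m -> R),
    (forall i, G (g i)) /\ p = \sum_i a i * g i.

Definition lspan (k : fieldType) (V : lmodType k) (G : set V) : set V :=
  fun p => exists (m : nat) (a : 'I_m -> k) (g : 'I_m -> V),
    (forall i, G (g i)) /\ p = \sum_i a i *: g i.

Definition is_basis (k : fieldType) (V : lmodType k) (W : set V)
    (d : nat) (b : 'I_d -> V) : Prop :=
  (forall c : 'I_d -> k, \sum_i c i *: b i = 0 -> forall i, c i = 0) /\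
  W = lspan (range b).

(* The dimension of a finite-dimensional subspace W, and 0 for a W which has no
   finite basis. *)
Definition kdim (k : fieldType) (V : lmodType k) (W : set V) : nat :=
  xget 0%N (fun d => exists b : 'I_d -> V, is_basis W b).

(* The least element of a nonempty P, and 0 if P is empty. *)
Definition nat_min (P : set nat) : nat :=
  xget 0%N (fun d => P d /\ forall d', P d' -> (d <= d')%N).

(** The polynomial ring in the edge variables *)

(* k[y_e : e in E(K_n)] *)
Notation edge_ring k n := {mpoly k[#|edge n|]}.

Section EdgeRing.
Variables (k : fieldType) (n : nat).
Implicit Types (e : edge n) (A M : {set edge n}).

Definition y_ e : edge_ring k n := 'X_(enum_rank e).

Definition ymon A : edge_ring k n := \prod_(e in A) y_ e.

(* The ideal (y_e : e in M); boolean, as quotient rings require it. *)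
Definition edge_ideal M : edge_ring k n -> bool :=
  fun p => `[< ideal_gen (fun q => exists2 e, e \in M & q = y_ e) p >].

Lemma edge_ideal_closed M : idealr_closed (edge_ideal M).
Proof.
split=> [||a u v].
- apply/asboolP; exists 0%N, (fun=> 0), (fun=> 0); split; first by case.
  by rewrite big_ord0.
- apply/negP=> /asboolP[m [a [g [Gg /(congr1 (meval (fun=> 0))) /eqP]]]].
  rewrite meval1 raddf_sum big1 ?oner_eq0 // => i _ /=.
  have [e _ ->] := Gg i.
  by rewrite mevalM mevalXU mulr0.
- move=> /asboolP[m1 [a1 [g1 [G1 ->]]]] /asboolP[m2 [a2 [g2 [G2 ->]]]].
  apply/asboolP; exists (m1 + m2)%N,
    (fun i => match split i with inl i => a * a1 i | inr i => a2 i end),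
    (fun i => match split i with inl i => g1 i | inr i => g2 i end).
  split=> [i|]; first by case: split.
  rewrite big_split_ord mulr_sumr /=; congr (_ + _); apply: eq_bigr => i _.
    by rewrite (unsplitK (inl i)) mulrA.
  by rewrite (unsplitK (inr i)).
Qed.

HB.instance Definition _ M :=
  isIdealr.Build (edge_ring k n) (edge_ideal M) (edge_ideal_closed M).

Definition edge_quot M :=
  {ideal_quot (edge_ideal M : idealr (edge_ring k n))}.
HB.instance Definition _ M := GRing.ComNzRing.on (edge_quot M).

Definition pi_ M (p : edge_ring k n) : edge_quot M :=
  (\pi_(edge_quot M) p)%qT.

(* The k-vector space structure of the quotient. *)
Definition quot_scale M (c : k) (x : edge_quot M) : edge_quot M :=
  pi_ M c%:MP * x.

Lemma pi_D M : {morph pi_ M : p q / p + q}. Proof. exact: rmorphD. Qed.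
Lemma pi_M M : {morph pi_ M : p q / p * q}. Proof. exact: rmorphM. Qed.
Lemma pi_1 M : pi_ M 1 = 1. Proof. exact: rmorph1. Qed.

Lemma quot_scaleA M a b (x : edge_quot M) :
  quot_scale a (quot_scale b x) = quot_scale (a * b) x.
Proof. by rewrite /quot_scale mulrA -pi_M -mpolyCM. Qed.
Lemma quot_scale1 M : left_id 1 (@quot_scale M).
Proof. by move=> x; rewrite /quot_scale mpolyC1 pi_1 mul1r. Qed.
Lemma quot_scaleDr M : right_distributive (@quot_scale M) +%R.
Proof. by move=> a x z; rewrite /quot_scale mulrDr. Qed.
Lemma quot_scaleDl M (x : edge_quot M) : {morph (@quot_scale M)^~ x : a b / a + b}.
Proof. by move=> a b; rewrite /quot_scale mpolyCD pi_D mulrDl. Qed.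

HB.instance Definition _ M := GRing.Zmodule_isLmodule.Build k (edge_quot M)
  (@quot_scaleA M) (@quot_scale1 M) (@quot_scaleDr M) (@quot_scaleDl M).

Definition cover_ideal (F : sgraph) : set (edge_ring k n) :=
  fun p => forall A, A \in copy_edge_sets n F -> edge_ideal A p.

Definition V_ (T : sgraph) : set (edge_ring k n) :=
  lspan (fun p => exists2 B, B \in copy_edge_sets n T & p = ymon B).

(* Every ymon M is squarefree, so M ranges over the squarefree monomials. *)
Definition alpha (T F : sgraph) : nat :=
  nat_min (fun d => exists2 M, cover_ideal F (ymon M) &
    d = kdim (fun p => V_ T p /\ edge_ideal M p)).

Definition max_dim_image (T F : sgraph) : nat :=
  \max_(M : {set edge n} | `[< cover_ideal F (ymon M) >])
    kdim (fun x => exists2 p, V_ T p & x = pi_ M p).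

End EdgeRing.

(* Main.v *)
Require Import Defs.
From mathcomp Require Import boolp classical_sets.
From mathcomp Require Import all_boot all_order all_algebra mpoly.

Set Implicit Arguments.
Unset Strict Implicit.
Unset Printing Implicit Defensive.

Import GRing.Theory.
Local Open Scope ring_scope.

(** Complementation [M = E(K_n) \ G] matches the squarefree monomials [y_M] of
    the cover ideal of [F] with the [F]-free graphs [G].  Since [T] has no
    isolated vertices, a copy of [T] is determined by its edge set.  The
    substitution [y_e := 0] for [e] in [M] kills the ideal generated by these
    variables, kills [y_B] when [B] meets [M] and fixes the other [y_B].  As
    distinct squarefree monomials are linearly independent, the kernel of
    [pi_M] on [V_T] has the [y_B] with [B] meeting [M] as a basis, and the
    images of the remaining [y_B], i.e. of the copies of [T] in [G], are a
    basis of the image. *)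

(** * Dimension of spans of finite families *)

Section Dimension.
Variables (k : fieldType) (V : lmodType k).

Lemma lspanP (I : finType) (S : {set I}) (f : I -> V) (G : set V) (p : V) :
    (forall x, G x <-> exists2 i, i \in S & x = f i) ->
  lspan G p <-> exists c : I -> k, p = \sum_(i in S) c i *: f i.
Proof.
move=> GP; split=> [[m [a [g [Gg ->]]]]|[c ->]].
  have /choice[h hP] (j : 'I_m) : exists i, i \in S /\ g j = f i.
    by have /GP[i Si gi] := Gg j; exists i.
  (* [h] chooses an index in [S] for each generator used; coefficients with the same index are added
     up. *)
  exists (fun i => \sum_(j | h j == i) a j).
  rewrite (partition_big h (mem S)) => [|j _]; last by case: (hP j).
  apply: eq_bigr => i _; rewrite scaler_suml; apply: eq_bigr => j /eqP <-.
  by case: (hP j) => _ ->.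
exists #|S|, (fun j => c (enum_val j)), (fun j => f (enum_val j)); split.
  by move=> j; apply/GP; exists (enum_val j); first exact: enum_valP.
by rewrite big_enum_val.
Qed.

Lemma lspan_rangeP d (b : 'I_d -> V) (p : V) :
  lspan (range b) p <-> exists c : 'I_d -> k, p = \sum_i c i *: b i.
Proof.
rewrite (@lspanP _ setT b) => [|x].
  by split=> -[c ->]; exists c; apply: eq_bigl => i; rewrite in_setT.
split=> [[i _ <-]|[i _ ->]]; exists i => //; exact: in_setT.
Qed.

(** Expanding each family in the other gives matrices whose product is the identity of size [d], and
    the rank of the first factor is at most its number of columns [d']. *)
Lemma basis_leq (W : set V) d d' (b : 'I_d -> V) (b' : 'I_d' -> V) :
  is_basis W b -> is_basis W b' -> (d <= d')%N.
Proof.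
move=> [free_b Wb] [_ Wb'].
have /choice[A bE] i : exists c : 'I_d' -> k, b i = \sum_j c j *: b' j.
  by apply/lspan_rangeP; rewrite -Wb' Wb; exists 1%N, (fun=> 1), (fun=> b i);
    split=> [_|]; [exists i|rewrite big_ord1 scale1r].
have /choice[B b'E] j : exists c : 'I_d -> k, b' j = \sum_i c i *: b i.
  by apply/lspan_rangeP; rewrite -Wb Wb'; exists 1%N, (fun=> 1), (fun=> b' j);
    split=> [_|]; [exists j|rewrite big_ord1 scale1r].
pose MA := \matrix_(i, j) A i j; pose MB := \matrix_(j, i) B j i.
(* Row [i] of the difference gives a relation among the [b l]: re-expanding [b i] through [b']
   returns [b i]. *)
have AB1 : MA *m MB = 1%:M.
  apply/matrixP=> i l; apply/eqP; rewrite -subr_eq0; apply/eqP; move: l.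
  apply: free_b; under eq_bigr do rewrite scalerBl.
  rewrite sumrB [X in _ - X](bigD1 i) //= mxE eqxx scale1r [X in _ - (_ + X)]big1.
    rewrite addr0 bE; apply/eqP; rewrite subr_eq0; apply/eqP.
    under [RHS]eq_bigr do rewrite b'E scaler_sumr.
    rewrite exchange_big; apply: eq_bigr => l _ /=.
    rewrite mxE scaler_suml; apply: eq_bigr => j _.
    by rewrite !mxE scalerA.
  by move=> l; rewrite mxE eq_sym => /negPf ->; rewrite scale0r.
have := mxrankM_maxl MA MB; rewrite AB1 mxrank1 => /leq_trans; apply.
exact: rank_leq_col.
Qed.

Lemma kdim_eq (W : set V) d (b : 'I_d -> V) : is_basis W b -> kdim W = d.
Proof.
move=> Wb; rewrite /kdim; case: xgetP => [d' _ [b' Wb']|/(_ d)[]]; last by exists b.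
by apply/eqP; rewrite eqn_leq (basis_leq Wb' Wb) (basis_leq Wb Wb').
Qed.

Lemma kdim_card (I : finType) (S : {set I}) (f : I -> V) (W : set V) :
    (forall c : I -> k, \sum_(i in S) c i *: f i = 0 ->
       forall i, i \in S -> c i = 0) ->
    (forall p, W p <-> exists c : I -> k, p = \sum_(i in S) c i *: f i) ->
  kdim W = #|S|.
Proof.
move=> free_f WP; apply: (@kdim_eq _ _ (fun j => f (enum_val j))); split.
  move=> c c0 j.
  (* Transport of [c] along [enum_val], with default value 0 outside [S]. *)
  pose c' i := if [pick j | enum_val j == i] is Some j then c j else 0.
  have c'E l : c' (enum_val l) = c l.
    rewrite /c'; case: pickP => [l' /eqP /enum_val_inj -> //|/(_ l)].
    by rewrite eqxx.
  rewrite -c'E; apply: free_f; last exact: enum_valP.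
  by rewrite big_enum_val -[RHS]c0; apply: eq_bigr => l _; rewrite c'E.
apply/funext=> p; apply/propext; rewrite WP; apply: iff_sym; apply: lspanP => x.
split=> [[j _ <-]|[i Si ->]]; first by exists (enum_val j); first exact: enum_valP.
by exists (enum_rank_in Si i); rewrite ?enum_rankK_in.
Qed.

End Dimension.

Lemma nat_min_eq (P : set nat) d :
  P d -> (forall d', P d' -> (d <= d')%N) -> nat_min P = d.
Proof.
move=> Pd dmin; rewrite /nat_min; case: xgetP => [d' _ [Pd' d'min]|/(_ d)[]//].
by apply/eqP; rewrite eqn_leq d'min // dmin.
Qed.

(** * Copies and their edge sets *)

Section Copies.
Variable n : nat.
Implicit Types (T F : sgraph) (G A B M : {set edge n}).

(** Each vertex of a copy comes from a vertex of [T] with a neighbour, hence lies on an edge of the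
    copy. *)
Lemma copy_vertices T G (H : {set 'I_n} * {set edge n}) :
  no_isolated T -> H \in copies T G -> H.1 = \bigcup_(e in H.2) val e.
Proof.
move=> hT; rewrite inE => /andP[/andP[_ /forall_inP He]].
move=> /existsP[f /and3P[_ /eqP fT /forallP fadj]].
apply/eqP; rewrite eqEsubset; apply/andP; split; last exact/bigcupsP.
apply/subsetP=> v; rewrite -fT => /imsetP[x _ ->].
have [y xy] := hT x; have /forallP/(_ y) := fadj x; rewrite xy eq_sym => /eqP.
move=> /exists_inP[e eH /eqP ve]; apply/bigcupP; exists e => //.
by rewrite ve set21.
Qed.

Lemma copiesE T G H :
  (H \in copies T G) = (H \in copies T [set: edge n]) && (H.2 \subset G).
Proof. by rewrite !inE /is_subgraph subsetT -andbA andbC. Qed.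

(** By [copy_vertices], [snd] is injective on copies. *)
Lemma card_copies T G : no_isolated T ->
  #|copies T G| = #|[set B in copy_edge_sets n T | B \subset G]|.
Proof.
move=> hT; rewrite -(@card_in_imset _ _ snd); last first.
  move=> [U A] [U' A'] HU HU' /= eA; rewrite -eA in HU' *.
  have /= -> := copy_vertices hT HU; have /= -> // := copy_vertices hT HU'.
apply: eq_card => B; rewrite inE; apply/imsetP/andP => [[H HG ->]|[]].
  move: HG; rewrite copiesE => /andP[HT HG]; split=> //; exact: imset_f.
by move=> /imsetP[H HT ->] HG; exists H; rewrite // copiesE HT.
Qed.

Lemma free_ofP F G :
  reflect (forall A, A \in copy_edge_sets n F -> ~~ (A \subset G)) (free_of F G).
Proof.
apply: (iffP eqP) => [F0 A /imsetP[H HF ->]|nF].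
  apply/negP=> HG; have : H \in copies F G by rewrite copiesE HF.
  by rewrite F0 in_set0.
apply/setP=> H; rewrite in_set0 copiesE; apply/negP=> /andP[HF].
by apply/negP/nF/imset_f.
Qed.

Lemma copy_edges_neq0 F A :
  no_isolated F -> A \in copy_edge_sets n F -> A != set0.
Proof.
move=> hF /imsetP[H]; rewrite inE => /andP[_ /existsP[f]].
move=> /and3P[_ _ /forallP fadj] ->.
have /card_gt0P[x _] := vertex_gt0 F.
have [y xy] := hF x; have /forallP/(_ y) := fadj x; rewrite xy eq_sym => /eqP.
by move=> /exists_inP[e eH _]; apply/set0Pn; exists e.
Qed.

(** This is rank-nullity for [pi_ M] on [V_ T]: the summands turn out to be the dimensions of kernel
    and image. *)
Lemma card_copies_split T M :
  (#|[set B in copy_edge_sets n T | ~~ (B \subset ~: M)]|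
   + #|[set B in copy_edge_sets n T | B \subset ~: M]|)%N = #|copy_edge_sets n T|.
Proof.
rewrite addnC -(cardsID [set B : {set edge n} | B \subset ~: M] (copy_edge_sets n T)).
by congr (_ + _)%N; apply: eq_card => B; rewrite !inE // andbC.
Qed.

End Copies.

(** * Squarefree monomials modulo the ideal of an edge set *)

Section SquarefreeMonomials.
Variables (k : fieldType) (n : nat).
Implicit Types (T F : sgraph) (G A B M : {set edge n}).
Implicit Types p q : edge_ring k n.

Definition edge_mnm A : 'X_{1..#|edge n|} :=
  [multinom (enum_val i \in A : nat) | i < #|edge n|].

Lemma edge_mnm_inj : injective edge_mnm.
Proof.
move=> A B eAB; apply/setP=> e.
have := congr1 (fun m : 'X_{1..#|edge n|} => m (enum_rank e)) eAB.
by rewrite !mnmE enum_rankK; do 2!case: (_ \in _).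
Qed.

Lemma ymonE A : ymon k A = 'X_[edge_mnm A].
Proof.
rewrite mpolyXE_id /ymon (reindex enum_rank) /=; last first.
  by apply: onW_bij; exact: enum_rank_bij.
rewrite big_mkcond; apply: eq_bigr => e _; rewrite mnmE enum_rankK.
by case: (e \in A); rewrite ?expr1 ?expr0.
Qed.

(** The coefficient at [edge_mnm B] isolates [c B], as distinct edge sets have distinct
    exponents. *)
Lemma ymon_free (S : {set {set edge n}}) (c : {set edge n} -> k) :
  \sum_(B in S) c B *: ymon k B = 0 -> forall B, B \in S -> c B = 0.
Proof.
move=> /(congr1 (fun p => p@_(edge_mnm _))) + B BS => /(_ B).
rewrite mcoeff0 linear_sum (bigD1 B) //= mcoeffZ ymonE mcoeffX eqxx mulr1.
rewrite big1 ?addr0 // => A /andP[_ nAB].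
by rewrite mcoeffZ ymonE mcoeffX (inj_eq edge_mnm_inj) (negPf nAB) mulr0.
Qed.

(** Staying inside the polynomial ring, this substitution lets coefficients detect non-membership in
    [edge_ideal M]. *)
Definition kill M p : edge_ring k n :=
  p \mPo [tuple if enum_val i \in M then 0 else 'X_i | i < #|edge n|].

Lemma kill_y M e : kill M (y_ k e) = if e \in M then 0 else y_ k e.
Proof. by rewrite /kill /y_ comp_mpolyXU -tnth_nth tnth_mktuple enum_rankK. Qed.

Lemma kill_ymon M B :
  kill M (ymon k B) = if [disjoint B & M] then ymon k B else 0.
Proof.
rewrite /kill /ymon rmorph_prod /=.
case: (boolP [disjoint B & M]) => [dBM|/pred0Pn[e /andP[/= eB eM]]].
  apply: eq_bigr => e eB; rewrite -[LHS]/(kill M _) kill_y.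
  by rewrite (disjointFr dBM eB).
by rewrite (bigD1 e) //= -[X in X * _]/(kill M _) kill_y eM mul0r.
Qed.

Lemma kill_edge_ideal M p : edge_ideal M p -> kill M p = 0.
Proof.
move=> /asboolP[m [a [g [Gg ->]]]]; rewrite /kill linear_sum big1 // => i _.
have [e eM ->] := Gg i.
by rewrite rmorphM /= -[X in _ * X]/(kill M _) kill_y eM mulr0.
Qed.

Lemma ymon_edge_ideal M B : edge_ideal M (ymon k B) = ~~ [disjoint B & M].
Proof.
apply/idP/idP=> [/kill_edge_ideal|].
  rewrite kill_ymon; case: ifP => // _ /(congr1 (mcoeff (edge_mnm B)))/eqP.
  by rewrite ymonE mcoeffX eqxx mcoeff0 oner_eq0.
case/pred0Pn=> e /andP[/= eB eM]; apply/asboolP.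
(* The factor [y_ k e] of a common edge is split off. *)
exists 1%N, (fun=> \prod_(i in B | i != e) y_ k i), (fun=> y_ k e).
by split=> [_|]; [exists e|rewrite big_ord1 /ymon (bigD1 e) //= mulrC].
Qed.

(** [ymon k M] lies in the ideal of a copy [A] exactly when [M] meets [A], that is, when [A] is not
    contained in [~: M]. *)
Lemma cover_idealP F M :
  cover_ideal F (ymon k M) <-> free_of F (~: M).
Proof.
split=> [cM|/free_ofP fM A AF].
  by apply/free_ofP=> A /cM; rewrite ymon_edge_ideal disjoint_sym disjoints_subset.
by rewrite ymon_edge_ideal disjoint_sym disjoints_subset; apply: fM.
Qed.

Lemma V_P T p : V_ T p <->
  exists c : {set edge n} -> k, p = \sum_(B in copy_edge_sets n T) c B *: ymon k B.
Proof. exact: lspanP. Qed.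

Lemma sum_disjoint (S : {set {set edge n}}) M (f : {set edge n} -> edge_ring k n) :
  \sum_(B in S) f B = \sum_(B in [set B in S | ~~ (B \subset ~: M)]) f B
    + \sum_(B in [set B in S | B \subset ~: M]) f B.
Proof.
rewrite (bigID (fun B => B \subset ~: M)) /= addrC.
by congr (_ + _); apply: eq_bigl => B; rewrite inE.
Qed.

Lemma edge_ideal_sum (S : {set {set edge n}}) M (c : {set edge n} -> k) :
  edge_ideal M (\sum_(B in [set B in S | ~~ (B \subset ~: M)]) c B *: ymon k B).
Proof.
have [I0 _ IM] := @edge_ideal_closed k n M.
elim/big_rec: _ => [//|B p]; rewrite inE => /andP[_ BM] pM.
rewrite -mul_mpolyC; apply: IM => //.
by rewrite -topredE /= ymon_edge_ideal disjoints_subset.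
Qed.

Lemma kill_sum (S : {set {set edge n}}) M (c : {set edge n} -> k) :
  kill M (\sum_(B in S) c B *: ymon k B) =
  \sum_(B in [set B in S | B \subset ~: M]) c B *: ymon k B.
Proof.
rewrite /kill linear_sum /= (bigID (fun B => B \subset ~: M)) /=.
rewrite [X in _ + X]big1 => [|B /andP[_ nBM]]; last first.
  rewrite linearZ /= -[X in _ *: X]/(kill M _) kill_ymon disjoints_subset.
  by rewrite (negPf nBM) scaler0.
rewrite addr0; apply: eq_big => [B|B /andP[_ BM]]; first by rewrite inE.
by rewrite linearZ /= -[X in _ *: X]/(kill M _) kill_ymon disjoints_subset BM.
Qed.

Lemma kdim_kernel T M :
  kdim (fun p => V_ T p /\ edge_ideal M p) =
  #|[set B in copy_edge_sets n T | ~~ (B \subset ~: M)]|.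
Proof.
apply: (@kdim_card _ _ _ _ (@ymon k n)) => [c|p]; first exact: ymon_free.
split=> [[/V_P[c ->] /kill_edge_ideal]|[c ->]].
  (* [kill M] leaves the part of [p] avoiding [M], so this part is 0. *)
  by rewrite kill_sum => c0; exists c; rewrite (sum_disjoint _ M) c0 addr0.
split; last exact: edge_ideal_sum.
apply/V_P; exists (fun B => if B \subset ~: M then 0 else c B).
rewrite [RHS](sum_disjoint _ M) [X in _ = _ + X]big1 ?addr0 => [|B].
  by apply: eq_bigr => B; rewrite inE => /andP[_ /negPf ->].
by rewrite inE => /andP[_ ->]; rewrite scale0r.
Qed.

Lemma pi_eq0 M p : (pi_ M p == 0) = edge_ideal M p.
Proof.
have := Quotient.idealrBE (edge_ideal M : idealr (edge_ring k n)) p 0.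
by rewrite subr0 => /esym; rewrite [X in _ == X]rmorph0.
Qed.

Lemma pi_Z M c p : pi_ M (c *: p) = c *: pi_ M p.
Proof. by rewrite -mul_mpolyC pi_M. Qed.

Lemma pi_lin (S : {set {set edge n}}) M (c : {set edge n} -> k) :
  pi_ M (\sum_(B in S) c B *: ymon k B) = \sum_(B in S) c B *: pi_ M (ymon k B).
Proof.
rewrite (big_morph (pi_ M) (@pi_D k n M) (id1 := 0)); last exact: rmorph0.
by apply: eq_bigr => B _; rewrite pi_Z.
Qed.

Lemma kdim_image T M :
  kdim (fun x => exists2 p : edge_ring k n, V_ T p & x = pi_ M p) =
  #|[set B in copy_edge_sets n T | B \subset ~: M]|.
Proof.
apply: (@kdim_card _ _ _ _ (fun B => pi_ M (ymon k B))) => [c|x].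
  (* A relation between images puts the combination in the ideal; [kill M] fixes it, since all its
     [B] avoid [M], so it is already 0 as a polynomial. *)
  rewrite -pi_lin => /eqP; rewrite pi_eq0 => /kill_edge_ideal.
  rewrite kill_sum (_ : [set B in _ | _] = [set B in copy_edge_sets n T | B \subset ~: M]).
    exact: ymon_free.
  by apply/setP=> B; rewrite !inE -andbA andbb.
split=> [[p /V_P[c ->] ->]|[c ->]].
  exists c; rewrite (sum_disjoint _ M) pi_D -pi_lin -[RHS]add0r.
  by congr (_ + _); apply/eqP; rewrite pi_eq0 edge_ideal_sum.
rewrite -pi_lin.
exists (\sum_(B in [set B in copy_edge_sets n T | B \subset ~: M]) c B *: ymon k B) => //.
apply/V_P; exists (fun B => if B \subset ~: M then c B else 0).
rewrite [RHS](sum_disjoint _ M) [X in _ = X + _]big1 ?add0r => [|B].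
  by apply: eq_bigr => B; rewrite inE => /andP[_ ->].
by rewrite inE => /andP[_ /negPf ->]; rewrite scale0r.
Qed.

End SquarefreeMonomials.

Theorem theorem5p3 (k : fieldType) (char0 : [pchar k] =i pred0)
  (T F : sgraph) (hT : no_isolated T) (hF : no_isolated F) (n : nat) :
  ((gen_turan n T F)%:Z = #|copy_edge_sets n T|%:Z - (alpha k n T F)%:Z) /\
  gen_turan n T F = max_dim_image k n T F.
Proof.
split; last first.
  rewrite /gen_turan /max_dim_image (reindex_inj (inv_inj (@setCK _))) /=.
  apply: eq_big => [M|M _]; last by rewrite kdim_image card_copies.
  by apply/idP/asboolP=> /cover_idealP.
(* The empty graph is [F]-free because copies of [F] have edges; hence the maximum is attained at
   some [G0]. *)
have free_gt0 : (0 < #|[pred G : {set edge n} | free_of F G]|)%N.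
  apply/card_gt0P; exists set0; apply/free_ofP=> A /(copy_edges_neq0 hF).
  by rewrite subset0.
have [G0 G0F exE] := eq_bigmax_cond (fun G : {set edge n} => #|copies T G|) free_gt0.
rewrite -[LHS]/(gen_turan n T F) in exE.
have splitE G := @card_copies_split n T (~: G).
have -> : alpha k n T F = (#|copy_edge_sets n T| - gen_turan n T F)%N.
  (* The minimum is attained at the complement of an extremal graph; for any other [M], the copies
     inside [~: M] number at most [gen_turan n T F]. *)
  apply: nat_min_eq => [|d [M /cover_idealP fM ->]].
    exists (~: G0); first by apply/cover_idealP; rewrite setCK.
    by rewrite kdim_kernel exE card_copies // -(splitE G0) !setCK addnK.
  rewrite kdim_kernel leq_subLR -(card_copies_split T M) addnC leq_add2r.
  by rewrite -card_copies // /gen_turan (bigmax_sup (~: M)).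
(* Truncated subtraction agrees with that of integers, as the copies in [G0] are among all
   copies. *)
rewrite -subzn ?opprB 1?addrC ?subrK // exE card_copies // -(splitE G0).
by rewrite setCK leq_addl.
Qed.
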